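(* Let $k,n$ be integers with $k\geq 2$ and $n-k\geq 2$, and let $t_1,\dotsc,t_{n-1}\in\mathbb{C}$ be distinct. Set $$f(t)\ =\ \prod_{i=1}^{n-1}(t-t_i).$$ Then the points of the intersection $$X_{\square}(t_1)\,\cap\,X_{\square}(t_2)\,\cap\,\dotsb\,\cap\,X_{\square}(t_{n-1})\,\cap\,X_{\lambda(k,n)}(\infty)$$ in $\mathrm{Gr}(k,n)$ may be identified with (are in bijection with) all ways of factoring $f'(t)=g(t)h(t)$ with complex polynomials $g,h$ satisfying $\deg g=k-1$ and $\deg h=n-k-1$ that are monic, where monic is understood up to the nonzero constant leading coefficient $n-1$ of $f'$ (i.e. one counts ordered pairs $(g,h)$ of monic polynomials of these degrees with $f'(t)=(n-1)\,g(t)h(t)$).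
   Context: $\mathrm{Gr}(k,n)$ is the Grassmannian of $k$-dimensional complex linear subspaces of $\mathbb{C}^n$. Let $\gamma(t)=(1,t,\tfrac{t^2}{2},\tfrac{t^3}{3!},\dotsc,\tfrac{t^{n-1}}{(n-1)!})\in\mathbb{C}^n$. For $t\in\mathbb{C}$, the osculating flag $F_\bullet(t)$ has $i$-dimensional subspace $F_i(t)=\mathrm{span}\{\gamma(t),\gamma'(t),\dotsc,\gamma^{(i-1)}(t)\}$, and $F_\bullet(\infty)$ has $F_i(\infty)=\mathrm{span}\{e_{n+1-i},\dotsc,e_n\}$, where $e_1,\dotsc,e_n$ is the standard basis. For a partition $\lambda$ with $n-k\geq\lambda_1\geq\dotsb\geq\lambda_k\geq 0$ and $t\in\mathbb{P}^1=\mathbb{C}\cup\{\infty\}$, the Schubert variety is $$X_\lambda(t)=\{H\in\mathrm{Gr}(k,n)\mid \dim H\cap F_{n-k+i-\lambda_i}(t)\geq i\ \text{ for } i=1,\dotsc,k\}.$$ $\square$ denotes the partition $(1,0,\dotsc,0)$, so $X_\square(t)=\{H\mid H\cap F_{n-k}(t)\neq 0\}$. $\lambda(k,n)$ denotes the partition $((n-k-1)^{k-1},0)$ (the part $n-k-1$ repeated $k-1$ times, followed by $0$), so $X_{\lambda(k,n)}(\infty)=\{H\mid \dim H\cap F_{i+1}(\infty)\geq i,\ i=1,\dotsc,k-1\}$. *)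

(* Defs.v *)
From HB Require Import structures.
From mathcomp Require Import all_boot all_order all_algebra.
From mathcomp Require Import classical_sets functions reals complex.
Set Implicit Arguments.
Unset Strict Implicit.
Unset Printing Implicit Defensive.
Import Order.TTheory GRing.Theory Num.Theory.
Local Open Scope ring_scope.
Local Open Scope classical_set_scope.

(* Coordinates and parts of partitions are numbered from 0: e_(j+1) is         *)
(* delta_mx 0 j, and lambda_(i+1) is nth 0 lambda i.                           *)
Section SchubertVarieties.
Variables (F : numFieldType) (n : nat).

(* The coordinates are kept as polynomials in t, so that derivatives of the    *)
(* curve are formal derivatives of its coordinates.                            *)
Definition moment_curve : 'rV[{poly F}]_n :=
  \row_(j < n) ((j`!)%:R^-1 *: 'X^j).

Definition moment_curve_deriv (m : nat) (t : F) : 'rV[F]_n :=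
  map_mx (fun p : {poly F} => p^`(m).[t]) moment_curve.

(* Points of P^1: Some t is t in F, and None is the point at infinity. *)
Definition osculating_flag (t : option F) (i : nat) : {vspace 'rV[F]_n} :=
  match t with
  | Some a => <<[seq moment_curve_deriv m a | m <- iota 0 i]>>%VS
  | None =>
      <<[seq (delta_mx 0%R j : 'rV[F]_n)
         | j : 'I_n <- enum 'I_n & (n - i <= j)%N]>>%VS
  end.

Definition Grassmannian (k : nat) : set {vspace 'rV[F]_n} :=
  [set H | \dim H = k].

(* Meaningful when n - k >= lambda_1 >= ... >= lambda_k >= 0; the natural      *)
(* number subtractions are then not truncated.                                 *)
Definition Schubert_variety (k : nat) (lambda : seq nat) (t : option F) :
    set {vspace 'rV[F]_n} :=
  [set H | Grassmannian k H /\
    forall i : nat, (1 <= i <= k)%N ->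
      (i <= \dim (H :&: osculating_flag t
                          (n - k + i - nth 0%N lambda i.-1))%VS)%N].

End SchubertVarieties.

Definition box_partition (k : nat) : seq nat := 1%N :: nseq k.-1 0%N.

Definition lambda_partition (k n : nat) : seq nat :=
  rcons (nseq k.-1 (n - k - 1)%N) 0%N.

Definition monic_factorizations (F : numFieldType) (k n : nat) (f : {poly F}) :
    set ({poly F} * {poly F}) :=
  [set gh | [/\ gh.1 \is monic, gh.2 \is monic,
                size gh.1 = k, size gh.2 = (n - k)%N &
                f^`() = n.-1%:R *: (gh.1 * gh.2)]].

(* Main.v *)
Require Import Defs.
From mathcomp Require Import all_boot all_order all_algebra.
From mathcomp Require Import classical_sets functions reals complex.
From mathcomp Require Import zify ring.
From HB Require Import structures.
Import Order.TTheory GRing.Theory Num.Theory.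
Local Open Scope ring_scope.
Local Open Scope classical_set_scope.
Set Implicit Arguments.
Unset Strict Implicit.
Unset Printing Implicit Defensive.

(** A row vector v of length n is turned into the polynomial
    [row_poly v] = sum_l v_(n-1-l) (-X)^l / l!, so that a point of Gr(k, n)
    becomes a k-dimensional space of polynomials of degree < n.  The m-th
    derivative of the moment curve at a becomes (a - X)^(n-1-m) / (n-1-m)!;
    hence F_i(a) becomes the multiples of (X - a)^(n-i), and F_i(infinity) the
    polynomials of degree < i.  For H in Gr(k, n) the Schubert conditions then
    read as follows.
    - Box condition at a: H has a nonzero element divisible by (X - a)^k
      ([Schubert_variety_box]).
    - Condition at infinity: H contains at least k - 1 independent polynomials
      of degree < k ([Schubert_variety_lambda]).

    The factorization comes from the Lagrange bilinear concomitant of the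
    operator (d/dX)^k,
      B(g, p) = sum_(m < k) (-1)^m p^(m) g^(k-1-m),
    which satisfies B(g, p)' = p g^(k) - (-1)^k p^(k) g.  When g has degree
    < k only the last term survives, so B(g, p) is a primitive of p^(k) g up to
    sign, and it is constant as soon as p has degree < k too; on polynomials of
    degree < k, B is a perfect pairing.  The points attached to f are the spaces
      V_g = {p of degree < n | B(g, p) is a scalar multiple of f}
    ([concomitant_space]), where g is a monic factor of degree k - 1 of f'.

    If f' = (n - 1) g h, integrating h k times and then adding a polynomial of
    degree < k to adjust a constant gives q with B(g, q) = f.  Hence
    V_g is spanned by q and the (k-1)-dimensional orthogonal of g among the
    polynomials of degree < k, which gives the condition at infinity.  At a root
    a of f, let r be the remainder of q modulo (X - a)^k: B(g, r) is a constant
    which vanishes because B(g, q) and B(g, q - r) both vanish at a.  So q - r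
    is in V_g, which is the box condition.

    Conversely, a point H of the intersection contains some polynomial of degree
    at least k (the box condition at one root of f excludes the space of all
    polynomials of degree < k), so it is spanned by a hyperplane W of the
    polynomials of degree < k and one further element q.  Choose g != 0
    orthogonal to W and put L = B(g, q).  The element of H divisible by
    (X - t_i)^k is a nonzero multiple of q modulo W, so L vanishes at every t_i.
    Since L has degree < n, it is a scalar multiple of f.  Differentiating,
    f' is a multiple of q^(k) g, and degrees force deg g = k - 1
    ([exists_monic_factorization]).  Finally V_g determines g, because it
    contains a q for which both B(g, q) = f and f' is proportional to q^(k) g
    ([concomitant_space_inj]). *)

(** * Iterated derivatives and divisibility by powers of X - a *)

Section Derivatives.
Variable F : numFieldType.
Implicit Types p q g : {poly F}.

Lemma size_derivn_leq (m d : nat) p :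
  (size p <= m + d)%N -> (size p^`(m) <= d)%N.
Proof.
move=> sp; apply/leq_sizeP => j dj; rewrite coef_derivn nth_default ?mul0rn //.
by rewrite (leq_trans sp) // leq_add2l.
Qed.

(** Characteristic 0 is what makes this an equivalence: the scalar i ^_ m
    picked up by the coefficient of X^i is zero in F only for i < m. *)
Lemma derivn_eq0 (m : nat) p : (p^`(m) == 0) = (size p <= m)%N.
Proof.
apply/eqP/idP => [p0|sp]; last first.
  by apply/eqP; rewrite -size_poly_leq0 size_derivn_leq // addn0.
apply/leq_sizeP => j mj; move/polyP/(_ (j - m)%N): p0.
rewrite coef_derivn subnKC // coef0 => /eqP.
by rewrite mulrn_eq0 -leqn0 leqNgt ffact_gt0 mj => /eqP.
Qed.

(** Term by term integration, m times. *)
Lemma exists_derivn (m : nat) q :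
  {p | p^`(m) = q & (size p <= m + size q)%N}.
Proof.
exists (\poly_(i < m + size q) (q`_(i - m) / (i ^_ m)%:R)); last exact: size_poly.
apply/polyP => i; rewrite coef_derivn coef_poly ltn_add2l addKn.
case: ltnP => [_|si]; last by rewrite mul0rn nth_default.
rewrite -[LHS]mulr_natr divfK // pnatr_eq0 -lt0n ffact_gt0 leq_addr //.
Qed.

Lemma dvdp_exp_deriv (a : F) (m : nat) p :
  ('X - a%:P) ^+ m.+1 %| p -> ('X - a%:P) ^+ m %| p^`().
Proof.
case/dvdpP => q ->; rewrite derivM deriv_exp derivXsubC mul1r /=.
by rewrite dvdp_add ?dvdp_mull ?dvdp_exp2l // -mulr_natl dvdp_mull.
Qed.

Lemma dvdp_exp_derivn (a : F) (i m : nat) p :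
  ('X - a%:P) ^+ (m + i) %| p -> ('X - a%:P) ^+ m %| p^`(i).
Proof.
elim: i m => [|i IHi] m; first by rewrite addn0.
by rewrite addnS -addSn => /IHi/dvdp_exp_deriv; rewrite derivnS.
Qed.

(** Taylor expansion at a, starting at order m. *)
Lemma dvdp_exp_sum (a : F) (m d : nat) p :
  ('X - a%:P) ^+ m %| p -> (size p <= m + d)%N ->
  exists c : nat -> F, p = \sum_(j < d) c j *: ('X - a%:P) ^+ (m + j).
Proof.
case/dvdpP => q -> sp; pose r := q \Po ('X + a%:P).
have sr : (size r <= d)%N.
  rewrite size_comp_poly2 ?size_XaddC //.
  have [->|q0] := eqVneq q 0; first by rewrite size_poly0.
  move: sp; rewrite size_Mmonic ?monic_exp ?monicXsubC // size_exp_XsubC.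
  by rewrite addnS /= addnC leq_add2l.
exists (fun j => r`_j).
rewrite -[q](comp_polyXaddC_K _ a) -/r mulrC comp_polyE mulr_sumr.
rewrite (big_ord_widen d (fun j => _ * (r`_j *: ('X - a%:P) ^+ j))) //.
rewrite big_mkcond; apply: eq_bigr => j _.
rewrite -scalerAr -exprD.
by case: ltnP => // rj; rewrite nth_default // scale0r.
Qed.
End Derivatives.

(** * The bilinear concomitant of the k-th derivative *)

Section Concomitant.
Variables (F : numFieldType) (k : nat).
Implicit Types p q g h : {poly F}.

(** The bilinear concomitant in the Lagrange identity for the operator
    (d/dX)^k and its adjoint (-1)^k (d/dX)^k. *)
Definition concomitant g p : {poly F} :=
  \sum_(m < k) (-1) ^+ m *: (p^`(m) * g^`(k.-1 - m)).

Fact concomitant_is_linear g : linear (concomitant g).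
Proof.
move=> c p q; rewrite /concomitant scaler_sumr -big_split /=.
apply: eq_bigr => m _.
by rewrite linearP /= mulrDl scalerDr -scalerAl !scalerA mulrC.
Qed.
HB.instance Definition _ g :=
  GRing.isLinear.Build F {poly F} {poly F} _ (concomitant g)
    (concomitant_is_linear g).

Lemma concomitantDl g h p :
  concomitant (g + h) p = concomitant g p + concomitant h p.
Proof.
rewrite /concomitant -big_split /=; apply: eq_bigr => m _.
by rewrite derivnD mulrDr scalerDr.
Qed.

Lemma concomitantZl c g p : concomitant (c *: g) p = c *: concomitant g p.
Proof.
rewrite /concomitant scaler_sumr; apply: eq_bigr => m _.
by rewrite derivnZ -scalerAr !scalerA mulrC.
Qed.

(** Lagrange identity: by the Leibniz rule the derivatives of consecutive
    terms telescope. *)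
Lemma deriv_concomitant g p :
  (concomitant g p)^`() = p * g^`(k) - (-1) ^+ k *: (p^`(k) * g).
Proof.
rewrite /concomitant raddf_sum /=.
rewrite -(big_mkord xpredT
  (fun m => ((-1) ^+ m *: (p^`(m) * g^`(k.-1 - m)))^`())).
rewrite (telescope_sumr_eq (fun m => - ((-1) ^+ m *: (p^`(m) * g^`(k - m))))) //.
  by rewrite subnn subn0 expr0 scale1r opprK addrC.
move=> m /andP[_ mk]; rewrite derivZ derivM -!derivnS opprK.
rewrite exprS mulN1r scaleNr opprK scalerDr addrC.
rewrite (_ : (k.-1 - m).+1 = (k - m)%N); last lia.
rewrite (_ : (k.-1 - m)%N = (k - m.+1)%N); last lia.
by rewrite addrC.
Qed.

(** In the m-th term p^(m) has degree at most deg p - m and g^(k-1-m) has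
    degree at most m. *)
Lemma size_concomitant (n : nat) g p :
  (size g <= k)%N -> (size p <= n)%N -> (size (concomitant g p) <= n)%N.
Proof.
move=> sg sp; rewrite /concomitant; apply: (leq_trans (size_sum _ _ _)).
apply/bigmax_leqP => m _; apply: (leq_trans (size_scale_leq _ _)).
have [->|p0] := eqVneq p^`(m) 0; first by rewrite mul0r size_poly0.
have mp : (m < size p)%N by rewrite ltnNge -derivn_eq0.
apply: (leq_trans (size_polyMleq _ _)).
have s1 : (size p^`(m) <= n - m)%N.
  by apply: size_derivn_leq; rewrite (leq_trans sp) // -leq_subLR.
have s2 : (size g^`(k.-1 - m) <= m.+1)%N.
  by apply: size_derivn_leq; have := ltn_ord m; lia.
lia.
Qed.

(** Both k-th derivatives in the Lagrange identity vanish. *)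
Lemma concomitant_const g p :
  (size g <= k)%N -> (size p <= k)%N -> exists c, concomitant g p = c%:P.
Proof.
move=> sg sp; exists (concomitant g p)`_0; apply: size1_polyC.
rewrite -derivn_eq0 derivn1 deriv_concomitant.
move: sg sp; rewrite -!derivn_eq0 => /eqP-> /eqP->.
by rewrite mulr0 mul0r scaler0 subr0.
Qed.

(** The pairing on polynomials of degree < k is perfect.  If g has degree d,
    then g pairs with X^(k-1-d) to a nonzero constant: any term other than
    m = k-1-d differentiates either X^(k-1-d) or g too often. *)
Lemma concomitant_nondegenerate g :
  g != 0 -> (size g <= k)%N ->
  exists2 p : {poly F}, (size p <= k)%N & concomitant g p = 1.
Proof.
move=> g0 sg; have sg0 : (0 < size g)%N by rewrite size_poly_gt0.
pose s := (k - size g)%N.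
have sk : (s < k)%N by rewrite /s; lia.
pose d : F := (-1) ^+ s * (s`!)%:R * (lead_coef g * ((size g).-1)`!%:R).
have d0 : d != 0.
  by rewrite !mulf_neq0 ?signr_eq0 ?pnatr_eq0 -?lt0n ?fact_gt0 // lead_coef_eq0.
(* d is the only surviving term of B(g, X^s). *)
exists (d^-1 *: 'X^s).
  by rewrite (leq_trans (size_scale_leq _ _)) // size_polyXn.
rewrite linearZ /= (_ : concomitant g 'X^s = d%:P).
  by rewrite -mul_polyC -polyCM mulVf.
rewrite /concomitant (bigD1 (Ordinal sk)) //= big1 ?addr0.
  rewrite derivnXn subnn ffactnn expr0.
  rewrite (_ : (k.-1 - s)%N = (size g).-1); last by rewrite /s; lia.
  rewrite (_ : g^`((size g).-1) = (lead_coef g * ((size g).-1)`!%:R)%:P).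
    rewrite -mul_polyC -(polyC1 F) -polyCMn -!polyCM; congr polyC.
    by rewrite /d !mulrA.
  apply/polyP => i; rewrite coef_derivn coefC.
  case: i => [|i] /=; last by rewrite nth_default ?mul0rn //; lia.
  by rewrite addn0 ffactnn -lead_coefE mulr_natr.
move=> m; rewrite -val_eqE /= => ms.
have [sm|] := ltnP s m.
  by rewrite derivnXn ffact_small // mulr0n mul0r scaler0.
rewrite leq_eqVlt (negbTE ms) /= => {}ms.
have /eqP-> : g^`(k.-1 - m) == 0 by rewrite derivn_eq0; move: ms; rewrite /s; lia.
by rewrite mulr0 scaler0.
Qed.

(** Only derivatives of p of order < k occur, and they all vanish at a. *)
Lemma concomitant_root (a : F) g p :
  ('X - a%:P) ^+ k %| p -> root (concomitant g p) a.
Proof.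
move=> pk; rewrite rootE /concomitant horner_sum big1 // => m _.
suff /rootP pm0: root p^`(m) a by rewrite hornerZ hornerM pm0 mul0r mulr0.
rewrite root_factor_theorem -(expr1 ('X - a%:P)).
by apply/dvdp_exp_derivn/(dvdp_trans _ pk)/dvdp_exp2l.
Qed.
End Concomitant.

(** * Osculating flags as spaces of polynomials *)

Section RowPolynomials.
Variables (F : numFieldType) (n : nat).
Implicit Types (v : 'rV[F]_n) (p q : {poly F}) (a : F).

(** Reversing the coordinates makes the flag at infinity the filtration by
    degree.  The weights (-1)^l / l! are those for which the derivatives of the
    moment curve at a become powers of a - X. *)
Definition row_poly v : {poly F} :=
  \sum_(l < n) (v 0 (rev_ord l) * ((-1) ^+ l / (l`!)%:R)) *: 'X^l.

Fact row_poly_is_linear : linear row_poly.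
Proof.
move=> c u v; rewrite /row_poly scaler_sumr -big_split /=.
by apply: eq_bigr => j _; rewrite !mxE mulrDl scalerDl scalerA mulrA.
Qed.
HB.instance Definition _ :=
  GRing.isLinear.Build F 'rV[F]_n {poly F} _ row_poly row_poly_is_linear.

Lemma coef_row_poly v (l : 'I_n) :
  (row_poly v)`_l = v 0 (rev_ord l) * ((-1) ^+ l / (l`!)%:R).
Proof.
rewrite /row_poly coef_sum (bigD1 l) //= big1 ?addr0.
  by rewrite coefZ coefXn eqxx mulr1.
by move=> i il; rewrite coefZ coefXn eq_sym val_eqE (negbTE il) mulr0.
Qed.

Lemma size_row_poly v : (size (row_poly v) <= n)%N.
Proof.
apply: (leq_trans (size_sum _ _ _)); apply/bigmax_leqP => l _.
by rewrite (leq_trans (size_scale_leq _ _)) // size_polyXn.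
Qed.

Lemma row_poly_weight_neq0 (l : nat) : (-1) ^+ l / (l`!)%:R != 0 :> F.
Proof. by rewrite mulf_neq0 ?signr_eq0 // invr_eq0 pnatr_eq0 -lt0n fact_gt0. Qed.

Lemma row_poly_inj : injective row_poly.
Proof.
move=> u v /polyP uv; apply/rowP => j; move: (uv (rev_ord j)).
by rewrite !coef_row_poly rev_ordK => /(mulIf (row_poly_weight_neq0 _)).
Qed.

Lemma exists_row_poly p : (size p <= n)%N -> exists v, row_poly v = p.
Proof.
move=> sp; pose e l : F := (-1) ^+ l / (l`!)%:R.
exists (\row_j (p`_(rev_ord j) / e (rev_ord j))).
apply/polyP => i; have [ni|ni] := leqP n i.
  by rewrite !nth_default ?(leq_trans sp) ?(leq_trans (size_row_poly _)).
rewrite (coef_row_poly _ (Ordinal ni)) mxE rev_ordK.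
by rewrite divfK ?row_poly_weight_neq0.
Qed.

Lemma exprN_polyC p (l : nat) : (- p) ^+ l = ((-1) ^+ l)%:P * p ^+ l.
Proof. by rewrite [LHS]exprNn polyC_exp polyCN. Qed.

(** Binomial expansion of (a - X)^(n-1-m): both sides have
    a^(n-1-m-l) / (n-1-m-l)! times (-X)^l / l! as term of degree l. *)
Lemma row_poly_moment_curve_deriv (m : nat) a : (m < n)%N ->
  row_poly (moment_curve_deriv n m a) =
  ((n.-1 - m)`!)%:R^-1 *: (a%:P - 'X) ^+ (n.-1 - m).
Proof.
move=> mn; set N := (n.-1 - m)%N; have Nn : (N < n)%N by rewrite /N; lia.
rewrite /row_poly exprDn scaler_sumr.
rewrite (big_ord_widen n (fun l => N`!%:R^-1 *:
  (a%:P ^+ (N - l) * (- 'X) ^+ l *+ 'C(N, l)))) //.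
rewrite [RHS]big_mkcond; apply: eq_bigr => -[l ln] _.
rewrite !mxE derivnZ derivnXn hornerZ hornerMn hornerXn ltnS /=.
have [lN|Nl] := leqP l N; last first.
  rewrite ffact_small ?mulr0n ?mulr0 ?mul0r ?scale0r //=.
  by move: Nl; rewrite /N; lia.
rewrite (_ : (n - l.+1 - m = N - l)%N); last by rewrite /N; lia.
rewrite exprN_polyC -polyC_exp [_%:P * (_ * _)]mulrA -polyCM mul_polyC.
rewrite -scaler_nat !scalerA; congr (_ *: _).
have fne j : j`!%:R != 0 :> F by rewrite pnatr_eq0 -lt0n fact_gt0.
have nm : (n - l.+1)`!%:R = ((n - l.+1) ^_ m)%:R * (N - l)`!%:R :> F.
  have -> : (N - l = n - l.+1 - m)%N by move: lN; rewrite /N; lia.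
  by rewrite -natrM ffact_fact //; move: lN; rewrite /N; lia.
have NE : N`!%:R = 'C(N, l)%:R * (l`!%:R * (N - l)`!%:R) :> F.
  by rewrite -!natrM bin_fact.
have ff : ((n - l.+1) ^_ m)%:R != 0 :> F.
  by apply: contraNneq (fne (n - l.+1)%N) => ff; rewrite nm ff mul0r.
have bb : 'C(N, l)%:R != 0 :> F by rewrite pnatr_eq0 -lt0n bin_gt0.
rewrite NE nm -mulr_natr; field.
by rewrite ff bb !fne.
Qed.

(** The generators of F_i(a) become the powers (X - a)^j with n-i <= j < n,
    up to scalars, and by Taylor expansion these span the multiples of
    (X - a)^(n-i) of degree < n. *)
Lemma mem_osculating_flag (i : nat) a v : (i <= n)%N ->
  (v \in osculating_flag n (Some a) i) =
  (('X - a%:P) ^+ (n - i) %| row_poly v).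
Proof.
move=> lein; apply/idP/idP.
  move/(@coord_span _ _ _ (in_tuple _)) => ->.
  rewrite linear_sum /=;
  apply: (big_ind (fun p => _ %| p)) => [||j _];
    [exact: dvdp0|exact: dvdp_add|].
  have jn : (j < i)%N by rewrite (leq_trans (ltn_ord j)) // size_map size_iota.
  rewrite linearZ /= (nth_map 0%N) ?size_iota // nth_iota // add0n.
  rewrite row_poly_moment_curve_deriv ?(leq_trans jn) //.
  rewrite -[a%:P - _]opprB exprN_polyC -!mul_polyC; do 3 apply: dvdp_mull.
  by apply: dvdp_exp2l; lia.
move/(@dvdp_exp_sum _ _ _ i); rewrite subnK // => /(_ (size_row_poly v)) [c vE].
suff -> : v = \sum_(j < i) (c j * ((n - i + j)`!)%:R * (-1) ^+ (n - i + j))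
     *: moment_curve_deriv n (i.-1 - j) a.
  rewrite /osculating_flag; apply: memv_suml => j _; apply/memvZ/memv_span.
  by apply: map_f; rewrite mem_iota add0n /=; have := ltn_ord j; lia.
apply: row_poly_inj; rewrite vE linear_sum; apply: eq_bigr => j _ /=.
have ji := ltn_ord j.
rewrite linearZ /= row_poly_moment_curve_deriv; last by lia.
rewrite (_ : (n.-1 - (i.-1 - j) = n - i + j)%N); last by lia.
set N := (n - i + j)%N.
rewrite -[a%:P - 'X]opprB exprN_polyC mul_polyC !scalerA; congr (_ *: _).
rewrite [_ * _^-1]mulrAC mulfK ?pnatr_eq0 -?lt0n ?fact_gt0 //.
by rewrite -mulrA -expr2 sqrr_sign mulr1.
Qed.

Lemma dim_rV : \dim {:'rV[F]_n} = n.
Proof. by rewrite dimvf /dim /= mul1n. Qed.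

(** The n derivatives span the whole space, so they are independent, and so
    are the first i of them. *)
Lemma dim_osculating_flag (i : nat) a :
  (i <= n)%N -> \dim (osculating_flag n (Some a) i) = i.
Proof.
move=> lein; pose X j := [seq moment_curve_deriv n m a | m <- iota 0 j].
have sX j : size (X j) = j by rewrite size_map size_iota.
have XX : X n = X i ++ [seq moment_curve_deriv n m a | m <- iota i (n - i)].
  by rewrite /X -map_cat -[i in iota i _]add0n -iotaD subnKC.
have /catl_free : free (X i ++ [seq moment_curve_deriv n m a | m <- iota i (n - i)]).
  rewrite -XX /free sX (_ : <<X n>>%VS = fullv) ?dim_rV //.
  apply/vspaceP => v; rewrite memvf [LHS](@mem_osculating_flag n a v) //.
  by rewrite subnn expr0 dvd1p.
by rewrite /free sX => /eqP.
Qed.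

Lemma mem_osculating_flag_infty (i : nat) v : (i <= n)%N ->
  (v \in osculating_flag n None i) = (size (row_poly v) <= i)%N.
Proof.
move=> lein; apply/idP/idP => [|sv].
  move/(@coord_span _ _ _ (in_tuple _)) => ->.
  rewrite linear_sum /=; apply: (leq_trans (size_sum _ _ _)).
  apply/bigmax_leqP => j _; rewrite linearZ /=.
  apply: (leq_trans (size_scale_leq _ _)).
  set w := _`_j.
  have /mapP[l + ->] : w \in [seq (delta_mx 0%R j : 'rV[F]_n)
         | j : 'I_n <- enum 'I_n & (n - i <= j)%N].
    by apply: mem_nth; exact: ltn_ord.
  rewrite mem_filter => /andP[il _].
  apply/leq_sizeP => m im.
  have [nm|mn] := leqP n m; first by rewrite nth_default // (leq_trans (size_row_poly _)).
  rewrite (coef_row_poly _ (Ordinal mn)) mxE /= -val_eqE /=.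
  by rewrite (_ : (_ == _ :> nat) = false) ?andbF ?mul0r //; lia.
rewrite /osculating_flag [v]row_sum_delta; apply: memv_suml => j _.
have [ij|ji] := leqP (n - i)%N j.
  apply/memvZ/memv_span/map_f.
  by rewrite mem_filter ij mem_enum.
have : (row_poly v)`_(rev_ord j) = 0.
  by rewrite nth_default // (leq_trans sv) //=; lia.
move/eqP; rewrite coef_row_poly rev_ordK mulf_eq0.
by rewrite (negbTE (row_poly_weight_neq0 _)) orbF => /eqP->; rewrite scale0r mem0v.
Qed.

Lemma dim_osculating_flag_infty (i : nat) :
  (i <= n)%N -> \dim (osculating_flag n (None : option F) i) = i.
Proof.
move=> lein.
pose X := [seq (delta_mx 0%R j : 'rV[F]_n) | j : 'I_n <- enum 'I_n].
have fX : free X.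
  rewrite /free size_map size_enum_ord (_ : <<X>>%VS = fullv) ?dim_rV //.
  apply/vspaceP => v; rewrite memvf (row_sum_delta v).
  by apply: memv_suml => j _; apply/memvZ/memv_span/map_f; rewrite mem_enum.
rewrite /osculating_flag; set Y := [seq _ | _ <- _ ].
have YX : subseq Y X by apply/map_subseq/filter_subseq.
have /eqP-> : free Y by rewrite (subseq_uniqP (free_uniq fX) YX) filter_free.
rewrite size_map size_filter -(count_map val (leq (n - i))) val_enum_ord.
rewrite -[X in iota 0 X](subnK lein) iotaD count_cat add0n.
rewrite (@eq_in_count _ _ pred0) => [|j]; last by rewrite mem_iota /=; lia.
rewrite (@eq_in_count _ (leq (n - i)) predT) => [|j]; last by rewrite mem_iota /=; lia.
by rewrite count_pred0 count_predT size_iota.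
Qed.

End RowPolynomials.

(** * Schubert conditions as conditions on polynomials *)

Section SchubertConditions.
Variables (F : numFieldType) (n k : nat).
Implicit Types (H : {vspace 'rV[F]_n}) (a : F).

Lemma dimv_cap_geq (U V W : {vspace 'rV[F]_n}) :
  (U <= W)%VS -> (V <= W)%VS ->
  (\dim U + \dim V <= \dim W + \dim (U :&: V))%N.
Proof. by move=> UW VW; rewrite -dimv_sum_cap leq_add2r dimvS // subv_add UW. Qed.

(** F_(n-k)(a) consists of the multiples of (X - a)^k, so the first condition
    is the stated one; the later conditions, with zero parts, hold for
    dimension reasons. *)
Lemma Schubert_variety_box H a : (0 < k <= n)%N ->
  Schubert_variety k (box_partition k) (Some a) H <->
  \dim H = k /\
  exists v, [/\ v \in H, v != 0 & ('X - a%:P) ^+ k %| row_poly v].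
Proof.
move=> /andP[k0 kn]; split=> [[Hk HF]|[Hk [v [vH v0 vk]]]]; split=> //.
  have /HF : (1 <= 1 <= k)%N by [].
  rewrite /= addnK lt0n dimv_eq0 -vpick0; set v := vpick _ => v0.
  have := memv_pick (H :&: osculating_flag n (Some a) (n - k))%VS.
  rewrite -/v memv_cap mem_osculating_flag ?leq_subr // subKn // => /andP[vH vk].
  by exists v.
case=> [//|[_|i ik]].
  rewrite /= addnK lt0n dimv_eq0 -subv0; apply: contra v0 => /subvP/(_ v).
  by rewrite memv_cap vH mem_osculating_flag ?leq_subr // subKn // memv0; apply.
have -> : nth 0%N (box_partition k) i.+2.-1 = 0%N by rewrite /= nth_nseq if_same.
have le_n : (n - k + i.+2 <= n)%N by lia.
have := dimv_cap_geq (subvf H) (subvf (osculating_flag n (Some a) (n - k + i.+2))).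
by rewrite Hk dim_osculating_flag // dim_rV subn0; lia.
Qed.

(** The conditions for i < k - 1 follow from the one for i = k - 1 because
    F_(i+1) has codimension k-1-i in F_k; for i = k the flag is everything. *)
Lemma Schubert_variety_lambda H : (2 <= k)%N -> (k < n)%N ->
  Schubert_variety k (lambda_partition k n) None H <->
  \dim H = k /\ (k.-1 <= \dim (H :&: osculating_flag n None k))%N.
Proof.
move=> k2 kn.
have nthl i : (i < k.-1)%N -> nth 0%N (lambda_partition k n) i = (n - k - 1)%N.
  by move=> ik; rewrite nth_rcons size_nseq ik nth_nseq ik.
split=> [[Hk HF]|[Hk HF]]; split=> //.
  have /HF : (1 <= k.-1 <= k)%N by lia.
  rewrite nthl; last by lia.
  by rewrite (_ : (_ - _)%N = k) //; lia.
move=> i /andP[i0 ik]; have [ik1|ki] := ltnP i.-1 k.-1; last first.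
  have -> : i = k by lia.
  rewrite /lambda_partition nth_rcons size_nseq ltnn eqxx subn0 subnK; last by lia.
  have /capv_idPl-> : (H <= osculating_flag n None n)%VS; last by rewrite Hk.
  by apply/subvP => v _; rewrite mem_osculating_flag_infty // size_row_poly.
rewrite nthl // (_ : (_ - _)%N = i.+1); last by lia.
set W := (H :&: osculating_flag n None k)%VS in HF.
have sub : (osculating_flag n (None : option F) i.+1 <= osculating_flag n None k)%VS.
  apply/subvP => v; rewrite !mem_osculating_flag_infty; [|lia|lia].
  by move/leq_trans; apply; lia.
have := dimv_cap_geq (capvSr H _) sub.
rewrite !dim_osculating_flag_infty; [|lia|lia]; rewrite -/W.
have := dimvS (capvS (capvSl H (osculating_flag n None k))
  (subvv (osculating_flag n None i.+1))).
by rewrite -/W; lia.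
Qed.

End SchubertConditions.

(** * The space of polynomials attached to a factor of the derivative *)

Section ConcomitantSpace.
Variables (F : numFieldType) (n k : nat).
Implicit Types (f g h p q : {poly F}) (v w : 'rV[F]_n).

(** The map p |-> B(g, p) on polynomials of degree < n, read on vectors.  The
    source is encoded by [row_poly], whose weights make the flags explicit; for
    the target plain coefficients suffice. *)
Definition concomitant_map g : 'Hom('rV[F]_n, 'rV[F]_n) :=
  linfun (poly_rV \o concomitant k g \o @row_poly F n).

Definition concomitant_space f g : {vspace 'rV[F]_n} :=
  (concomitant_map g @^-1: <[poly_rV f]>)%VS.

Lemma poly_rV_eq0 p : (size p <= n)%N ->
  (poly_rV p == 0 :> 'rV[F]_n) = (p == 0).
Proof.
move=> sp; apply/eqP/eqP => [p0|->]; last exact: linear0.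
by rewrite -(poly_rV_K sp) p0 linear0.
Qed.

Lemma rVpoly_concomitant_map g v : (size g <= k)%N ->
  rVpoly (concomitant_map g v) = concomitant k g (row_poly v).
Proof.
move=> sg; rewrite lfunE /= poly_rV_K // size_concomitant //.
exact: size_row_poly.
Qed.

Lemma mem_concomitant_ker g v : (size g <= k)%N ->
  (v \in lker (concomitant_map g)) = (concomitant k g (row_poly v) == 0).
Proof.
move=> sg; rewrite memv_ker -rVpoly_concomitant_map //.
by rewrite -(can_eq rVpolyK) linear0.
Qed.

Lemma mem_concomitant_space f g v : (size g <= k)%N -> (size f <= n)%N ->
  (v \in concomitant_space f g) <->
  exists c, concomitant k g (row_poly v) = c *: f.
Proof.
move=> sg sf; rewrite -memv_preim -rVpoly_concomitant_map //.
split=> [/vlineP[c ->]|[c Lv]].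
  by exists c; rewrite linearZ /= poly_rV_K.
apply/vlineP; exists c; apply: (can_inj rVpolyK).
by rewrite Lv linearZ /= poly_rV_K.
Qed.

(** The Lagrange identity when the adjoint term is zero: B(g, p) is, up to
    sign, a primitive of p^(k) g. *)
Lemma deriv_concomitant_size g p : (size g <= k)%N ->
  (concomitant k g p)^`() = (-1) ^+ k.+1 *: (p^`(k) * g).
Proof.
rewrite -derivn_eq0 deriv_concomitant => /eqP->.
by rewrite mulr0 sub0r exprS mulN1r scaleNr.
Qed.

(** On polynomials of degree < k the map B(g, -) takes constant values and is
    not zero, so its kernel there is a hyperplane. *)
Lemma dim_concomitant_ker g : (0 < k <= n)%N -> g != 0 -> (size g <= k)%N ->
  \dim (osculating_flag n None k :&: lker (concomitant_map g)) = k.-1.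
Proof.
move=> /andP[k0 kn] g0 sg; set U := osculating_flag n None k.
have := limg_ker_dim (concomitant_map g) U; rewrite dim_osculating_flag_infty //.
suff -> : (concomitant_map g @: U)%VS = <[poly_rV 1]>%VS.
  rewrite dim_vline poly_rV_eq0 ?size_poly1 ?(leq_trans k0) //.
  by rewrite oner_eq0 addn1 => <-.
apply/vspaceP => u; apply/idP/idP => [/memv_imgP[v + ->]|/vlineP[c ->]].
  rewrite mem_osculating_flag_infty // => sv.
  have [c Lc] := concomitant_const sg sv.
  apply/vlineP; exists c; rewrite lfunE /= Lc -[c%:P]mulr1 mul_polyC.
  exact: linearZ.
have [p sp Lp] := concomitant_nondegenerate g0 sg.
have [v vp] := exists_row_poly (leq_trans sp kn).
apply: memvZ; apply/memv_imgP; exists v.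
  by rewrite mem_osculating_flag_infty // vp.
by rewrite lfunE /= vp Lp.
Qed.

(** The kernel of B(g, -) lies in degree < k, because B(g, p) = 0 forces
    p^(k) g = 0; so it has dimension k - 1, and a preimage q of f adds one. *)
Lemma dim_concomitant_space f g q :
  (0 < k <= n)%N -> (size g <= k)%N -> (size f <= n)%N -> g != 0 -> f != 0 ->
  (size q <= n)%N -> concomitant k g q = f -> \dim (concomitant_space f g) = k.
Proof.
move=> kn sg sf g0 f0 sq Lq; have [k0 lekn] := andP kn.
rewrite -(limg_ker_dim (concomitant_map g)) lpreimK; last first.
  have [v vq] := exists_row_poly sq.
  rewrite -memvE; apply/memv_imgP; exists v; first exact: memvf.
  by rewrite lfunE /= vq Lq.
rewrite dim_vline poly_rV_eq0 // f0.
rewrite (_ : (_ :&: _)%VS = (osculating_flag n None k :&: lker (concomitant_map g))%VS).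
  by rewrite dim_concomitant_ker // addn1 prednK.
apply/vspaceP => v; rewrite !memv_cap mem_concomitant_ker //.
have [Lv|] := eqVneq (concomitant _ _ _) 0; last by rewrite !andbF.
rewrite !andbT mem_osculating_flag_infty // -derivn_eq0.
have -> : v \in concomitant_space f g.
  by apply/mem_concomitant_space => //; exists 0; rewrite scale0r.
apply/esym; move/eqP: (congr1 (@deriv F) Lv).
rewrite deriv_concomitant_size // linear0 scaler_eq0 signr_eq0 mulf_eq0.
by rewrite (negbTE g0) orbF.
Qed.

(** Orthogonality to a basis of W imposes fewer than k linear conditions on the
    k coefficients of g. *)
Lemma exists_concomitant_ker (W : {vspace 'rV[F]_n}) : (k <= n)%N ->
  (W <= osculating_flag n None k)%VS -> (\dim W < k)%N ->
  exists g, [/\ g != 0, (size g <= k)%N &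
    forall w, w \in W -> concomitant k g (row_poly w) = 0].
Proof.
move=> kn WU dW.
(* B of two polynomials of degree < k is a constant, so its coefficient of
   degree 0 is all of it. *)
pose M (x : 'rV[F]_k) : 'rV[F]_(\dim W) :=
  \row_i (concomitant k (rVpoly x) (row_poly (vbasis W)`_i))`_0.
have linM : linear M.
  move=> c x y; apply/rowP => i; rewrite !mxE linearP /=.
  by rewrite concomitantDl concomitantZl coefD coefZ.
pose MM : {linear 'rV[F]_k -> 'rV[F]_(\dim W)} :=
  HB.pack M (GRing.isLinear.Build _ _ _ _ M linM).
have : lker (linfun MM) != 0%VS.
  rewrite -dimv_eq0 -lt0n; have := limg_ker_dim (linfun MM) fullv.
  rewrite capfv dim_rV; have := dimvS (subvf (limg (linfun MM))).
  by rewrite dim_rV; move: dW; lia.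
rewrite -vpick0; set x := vpick _ => x0.
have := memv_pick (lker (linfun MM)); rewrite -/x memv_ker lfunE /= => /eqP Mx.
exists (rVpoly x); split.
  by apply: contraNneq x0 => x0; rewrite -[x]rVpolyK x0 linear0.
  exact: size_poly.
move=> w wW; rewrite (coord_vbasis wW) (linear_sum (@row_poly F n)).
rewrite linear_sum big1 // => i _.
rewrite !linearZ /=.
have iW : (vbasis W)`_i \in W by rewrite vbasis_mem // mem_nth ?size_tuple.
have si : (size (row_poly (vbasis W)`_i) <= k)%N.
  by rewrite -mem_osculating_flag_infty // (subvP WU).
have [c Lc] := concomitant_const (size_poly _ _ : (size (rVpoly x) <= k)%N) si.
have := congr1 (fun y : 'rV_ _ => y 0 i) Mx; rewrite !mxE Lc coefC /= => ->.
by rewrite scaler0.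
Qed.

End ConcomitantSpace.

(** * Factorizations of the derivative and points of the intersection *)

Section Correspondence.
Variables (F : numFieldType) (n k : nat) (f : {poly F}).
Hypotheses (k2 : (2 <= k)%N) (kn2 : (2 <= n - k)%N).
Hypotheses (f_monic : f \is monic) (size_f : size f = n).
Implicit Types (g h p q : {poly F}) (H : {vspace 'rV[F]_n}).

Let kn : (0 < k <= n)%N. Proof. lia. Qed.
Let size_f_leq : (size f <= n)%N. Proof. by rewrite size_f. Qed.
Let n1_neq0 : n.-1%:R != 0 :> F. Proof. by rewrite pnatr_eq0; lia. Qed.
Let f_neq0 : f != 0. Proof. exact: monic_neq0. Qed.

Lemma coef_deriv_monic : (f^`())`_(n.-2) = n.-1%:R.
Proof.
rewrite coef_deriv (_ : n.-2.+1 = n.-1); last by lia.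
by have /monicP := f_monic; rewrite lead_coefE size_f => ->.
Qed.

Lemma size_deriv_monic : size f^`() = n.-1.
Proof.
apply/eqP; rewrite eqn_leq -{1}derivn1 size_derivn_leq /=; last by rewrite size_f; lia.
rewrite (_ : n.-1 = n.-2.+1); last by lia.
rewrite ltnNge; apply/negP => /leq_sizeP/(_ _ (leqnn _))/eqP.
by rewrite coef_deriv_monic pnatr_eq0; lia.
Qed.

Lemma lead_coef_deriv_monic : lead_coef f^`() = n.-1%:R.
Proof. by rewrite lead_coefE size_deriv_monic coef_deriv_monic. Qed.

Lemma deriv_monic_neq0 : f^`() != 0.
Proof. by rewrite -size_poly_gt0 size_deriv_monic; lia. Qed.

(** Integrate h k times to get q: by the Lagrange identity B(g, q) and f have
    the same derivative, and the missing constant is B(g, p) for some p of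
    degree < k. *)
Lemma exists_concomitant g h : monic_factorizations k n f (g, h) ->
  exists2 q : {poly F}, (size q <= n)%N & concomitant k g q = f.
Proof.
case=> /= gm hm sg sh fE.
have [q qh sq] := exists_derivn k (((-1) ^+ k.+1 * n.-1%:R) *: h).
have sqn : (size q <= n)%N.
  rewrite (leq_trans sq) // -[leqRHS](subnKC (proj2 (andP kn))) leq_add2l.
  by rewrite -sh size_scale_leq.
have sgk : (size g <= k)%N by rewrite sg.
have /size1_polyC : (size (f - concomitant k g q)%R <= 1)%N.
  rewrite -derivn_eq0 derivn1 derivB deriv_concomitant_size // qh fE.
  by rewrite -scalerAl !scalerA mulrA -expr2 sqrr_sign mul1r mulrC subrr.
set c := _`_0 => fc.
have [p sp Lp] := concomitant_nondegenerate (monic_neq0 gm) sgk.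
exists (q + c *: p).
  rewrite (leq_trans (size_polyD _ _)) // geq_max sqn.
  by rewrite (leq_trans (size_scale_leq _ _)) // (leq_trans sp); lia.
by rewrite linearD linearZ /= Lp alg_polyC -fc addrC subrK.
Qed.

Lemma concomitant_space_Grassmannian g h : monic_factorizations k n f (g, h) ->
  \dim (concomitant_space n k f g) = k.
Proof.
move=> fgh; have [q sq Lq] := exists_concomitant fgh.
case: fgh => /= gm _ sg _ _.
by apply: dim_concomitant_space Lq; rewrite ?sg ?size_f ?monic_neq0.
Qed.

Lemma concomitant_space_Schubert_lambda g h :
  monic_factorizations k n f (g, h) ->
  Schubert_variety k (lambda_partition k n) None (concomitant_space n k f g).
Proof.
move=> fgh; apply/Schubert_variety_lambda => //; first by lia.
split; first exact: concomitant_space_Grassmannian fgh.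
case: fgh => /= gm _ sg _ _.
rewrite -(dim_concomitant_ker kn (monic_neq0 gm)) ?sg //.
apply: dimvS; apply/subvP => v; rewrite !memv_cap mem_concomitant_ker ?sg //.
move=> /andP[-> /eqP Lv]; rewrite andbT.
by apply/mem_concomitant_space; rewrite ?sg //; exists 0; rewrite scale0r.
Qed.

(** With r the remainder of a solution q of B(g, q) = f modulo (X - a)^k, the
    constant B(g, r) is the value at a of B(g, q) - B(g, q - r), hence 0; so
    q - r is an element of the space that (X - a)^k divides. *)
Lemma concomitant_space_Schubert_box g h a :
  monic_factorizations k n f (g, h) -> root f a ->
  Schubert_variety k (box_partition k) (Some a) (concomitant_space n k f g).
Proof.
move=> fgh fa; apply/Schubert_variety_box => //.
split; first exact: concomitant_space_Grassmannian fgh.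
have [q sq Lq] := exists_concomitant fgh; case: fgh => /= gm _ sg _ _.
have sgk : (size g <= k)%N by rewrite sg.
pose d := ('X - a%:P) ^+ k; pose r := q %% d.
have sr : (size r <= k)%N.
  by rewrite -ltnS -(size_exp_XsubC k a) ltn_modp expf_neq0 // polyXsubC_eq0.
have dqr : d %| q - r by rewrite /r {1}(divp_eq q d) addrK dvdp_mull.
have [c Lr] := concomitant_const sgk sr.
have c0 : c = 0.
  have /rootP := concomitant_root g dqr.
  rewrite linearB /= Lq Lr hornerD hornerN hornerC (rootP fa) sub0r => /eqP.
  by rewrite oppr_eq0 => /eqP.
have Lqr : concomitant k g (q - r) = f by rewrite linearB /= Lq Lr c0 subr0.
have sqr : (size (q - r)%R <= n)%N.
  rewrite (leq_trans (size_polyD _ _)) // geq_max sq size_polyN.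
  by rewrite (leq_trans sr) //; lia.
have [v vqr] := exists_row_poly sqr.
exists v; split; last by rewrite vqr.
  by apply/mem_concomitant_space => //; exists 1; rewrite vqr Lqr scale1r.
by apply: contraNneq f_neq0 => v0; rewrite -Lqr -vqr v0 !linear0.
Qed.

(** A common q with B(g, q) = f and B(g', q) = c f satisfies, after
    differentiation, q^(k) g' = c q^(k) g with q^(k) != 0. *)
Lemma concomitant_space_inj g h g' h' :
  monic_factorizations k n f (g, h) -> monic_factorizations k n f (g', h') ->
  concomitant_space n k f g = concomitant_space n k f g' -> (g, h) = (g', h').
Proof.
move=> fgh [/= gm' hm' sg' sh' fE'] eqgg'.
have [q sq Lq] := exists_concomitant fgh; case: fgh => /= gm hm sg sh fE.
have [v vq] := exists_row_poly sq.
have : v \in concomitant_space n k f g.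
  by apply/mem_concomitant_space; rewrite ?sg //; exists 1; rewrite vq Lq scale1r.
rewrite eqgg' => /mem_concomitant_space; rewrite sg' vq.
move=> /(_ (leqnn k) size_f_leq) [c Lq'].
have f'q : f^`() = (-1) ^+ k.+1 *: (q^`(k) * g).
  by rewrite -deriv_concomitant_size ?sg // Lq.
have cf'q : c *: f^`() = (-1) ^+ k.+1 *: (q^`(k) * g').
  by rewrite -deriv_concomitant_size ?sg' // Lq' derivZ.
have q0 : q^`(k) != 0.
  by apply: contraNneq deriv_monic_neq0 => q0; rewrite f'q q0 mul0r scaler0.
have g'E : g' = c *: g.
  apply: (mulfI q0); apply: (scalerI (negbT (signr_eq0 F k.+1))).
  by rewrite -cf'q f'q -scalerAr !scalerA mulrC.
have c1 : c = 1.
  by move/monicP: gm'; rewrite g'E lead_coefZ (monicP gm) mulr1.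
have gg' : g' = g by rewrite g'E c1 scale1r.
congr pair => //; apply: (mulfI (monic_neq0 gm)).
by apply: (scalerI n1_neq0); rewrite -fE fE' gg'.
Qed.

(** The divisibility hypothesis says that f splits with simple roots, in the
    form in which it is applied to B(g, q); the root a0 is there to exhibit an
    element of H of degree at least k. *)
Lemma exists_monic_factorization H (a0 : F) :
  root f a0 ->
  (forall p, (forall a, root f a -> root p a) -> f %| p) ->
  (forall a, root f a -> Schubert_variety k (box_partition k) (Some a) H) ->
  Schubert_variety k (lambda_partition k n) None H ->
  exists g h, monic_factorizations k n f (g, h) /\ concomitant_space n k f g = H.
Proof.
move=> fa0 f_sep Hbox /Schubert_variety_lambda[//||dH]; first by lia.
set U := osculating_flag n None k; set W := (H :&: U)%VS => dW.
have memU v : (v \in U) = (size (row_poly v) <= k)%N.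
  by rewrite mem_osculating_flag_infty //; lia.
have box a : root f a ->
    exists v, [/\ v \in H, v \notin U & ('X - a%:P) ^+ k %| row_poly v].
  move=> /Hbox /Schubert_variety_box-/(_ kn) [_ [v [vH v0 vk]]].
  exists v; split=> //; apply: contra v0; rewrite memU => sv.
  have : row_poly v = 0.
    apply/eqP; apply: contraTT vk => v0; apply: contraL sv => /dvdp_leq-/(_ v0).
    by rewrite size_exp_XsubC -ltnNge.
  by rewrite -(linear0 (@row_poly F n)) => /row_poly_inj ->.
have [v0 [v0H v0U _]] := box _ fa0.
have WH : (W <= H)%VS by exact: capvSl.
have v0W : v0 \notin W by rewrite memv_cap (negbTE v0U) andbF.
have dWk : (\dim W < k)%N.
  rewrite ltn_neqAle -{2}dH dimvS // andbT; apply: contra v0W => /eqP dWk.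
  have /eqP-> : W == H by rewrite eqEdim WH dH dWk leqnn.
  by [].
have HW : H = (W + <[v0]>)%VS.
  apply/eqP; rewrite eq_sym eqEdim subv_add WH -memvE v0H /= dH.
  have : (\dim W < \dim (W + <[v0]>))%N; last by move: dW; lia.
  rewrite ltn_neqAle dimvS ?addvSl // andbT; apply: contra v0W => /eqP dWv.
  have /eqP-> : W == (W + <[v0]>)%VS by rewrite eqEdim addvSl dWv leqnn.
  by rewrite (subvP (addvSr _ _)) // memv_line.
have [g [g0 sg LW]] := exists_concomitant_ker (proj2 (andP kn)) (capvSr H U) dWk.
pose q := row_poly v0; pose L := concomitant k g q.
have LH v : v \in H ->
    exists2 c, concomitant k g (row_poly v) = c *: L & c = 0 -> v \in U.
  rewrite HW => /memv_addP[w wW [_ /vlineP[c ->] ->]].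
  exists c.
    have -> : row_poly (w + c *: v0) = row_poly w + c *: q.
      by rewrite linearD linearZ.
    by rewrite linearD linearZ /= LW // add0r.
  by move=> ->; rewrite scale0r addr0 (subvP (capvSr H U)).
have sq : (size q <= n)%N by exact: size_row_poly.
have qk0 : q^`(k) != 0 by rewrite derivn_eq0 -memU.
have L' : L^`() = (-1) ^+ k.+1 *: (q^`(k) * g) by rewrite deriv_concomitant_size.
have L0 : L != 0.
  apply/eqP => L0; move/eqP: L'; rewrite L0 linear0 eq_sym scaler_eq0 signr_eq0.
  by rewrite mulf_eq0 (negbTE qk0) (negbTE g0).
have fL : f %| L.
  apply: f_sep => a /box[v [vH vU va]].
  have [c Lv cU] := LH v vH.
  have c0 : c != 0 by apply: contra vU => /eqP/cU.
  by have := concomitant_root g va; rewrite Lv rootZ.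
(* f divides L, and L has degree < n = size f. *)
have [c c0 Lf] : exists2 c, c != 0 & L = c *: f.
  have : f %= L.
    rewrite -(dvdp_size_eqp fL) size_f eqn_leq (size_concomitant sg sq) andbT.
    by rewrite -size_f dvdp_leq.
  by rewrite eqp_sym => /eqpf_eq.
pose h := q^`(k).
pose g1 := (lead_coef g)^-1 *: g; pose h1 := (lead_coef h)^-1 *: h.
have lg0 : lead_coef g != 0 by rewrite lead_coef_eq0.
have lh0 : lead_coef h != 0 by rewrite lead_coef_eq0.
have gm : g1 \is monic by rewrite monicE lead_coefZ mulVf.
have hm : h1 \is monic by rewrite monicE lead_coefZ mulVf.
have [d fd] : exists d, f^`() = d *: (g1 * h1).
  exists (c^-1 * (-1) ^+ k.+1 * (lead_coef g * lead_coef h)).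
  have -> : f^`() = c^-1 *: L^`() by rewrite Lf derivZ scalerA mulVf ?scale1r.
  rewrite L' /g1 /h1 -scalerAl -scalerAr !scalerA mulrC.
  congr (_ *: _); last exact: mulrC.
  by field; rewrite c0 lg0 lh0.
(* Compare leading coefficients: those of g1 and h1 are 1. *)
have dn : d = n.-1%:R.
  rewrite -lead_coef_deriv_monic fd lead_coefZ lead_coefM.
  by rewrite (monicP gm) (monicP hm) !mulr1.
have d0 : d != 0 by rewrite dn.
have sg1 : size g1 = size g by rewrite size_scale ?invr_eq0.
have sh1 : size h1 = size h by rewrite size_scale ?invr_eq0.
have sh : (size h <= n - k)%N
  by apply: size_derivn_leq; rewrite subnKC //; case/andP: kn.
have := size_deriv_monic.
rewrite fd size_scale // size_monicM ?monic_neq0 // sg1 sh1 => sgh.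
have h_gt0 : (0 < size h)%N by rewrite size_poly_gt0.
(* The bounds deg g <= k-1 and deg h <= n-k-1 add up to deg f', hence are
   equalities. *)
have [sgk shk] : size g = k /\ size h = (n - k)%N.
  move: sg sh h_gt0 sgh; move: (size g) (size h) => a b.
  by clear -k2 kn2; lia.
have fgh : monic_factorizations k n f (g1, h1).
  by split; rewrite //= ?sg1 ?sh1 -?dn.
exists g1, h1; split=> //; apply/eqP; rewrite eq_sym eqEdim.
rewrite (concomitant_space_Grassmannian fgh) dH leqnn andbT.
apply/subvP => v /LH[e Lv _]; apply/mem_concomitant_space; rewrite ?sg1 //.
exists ((lead_coef g)^-1 * e * c).
by rewrite concomitantZl Lv Lf !scalerA.
Qed.

End Correspondence.

(** * The bijection *)

Theorem theorem7 (R : realType) (k n : nat) (t : 'I_n.-1 -> R[i])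
    (hk : (2 <= k)%N) (hnk : (2 <= n - k)%N) (ht : injective t) :
  let f : {poly R[i]} := \prod_(i < n.-1) ('X - (t i)%:P) in
  exists phi : {vspace 'rV[R[i]]_n} -> {poly R[i]} * {poly R[i]},
    set_bij
      ((\bigcap_(i in [set: 'I_n.-1])
          Schubert_variety k (box_partition k) (Some (t i))) `&`
       Schubert_variety k (lambda_partition k n) None)
      (monic_factorizations k n f)
      phi.
Proof.
move=> f.
have fm : f \is monic by exact: monic_prod_XsubC.
have fE : f = \prod_(a <- [seq t i | i <- enum 'I_n.-1]) ('X - a%:P).
  by rewrite big_map big_enum.
have sf : size f = n by rewrite fE size_prod_XsubC size_map size_enum_ord; lia.
have rootf a : root f a = (a \in [seq t i | i <- enum 'I_n.-1]).
  by rewrite fE root_prod_XsubC.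
have ft i : root f (t i) by rewrite rootf map_f ?mem_enum.
have f_sep (p : {poly R[i]}) : (forall a, root f a -> root p a) -> f %| p.
  move=> fp; rewrite fE; apply: uniq_roots_dvdp.
    by apply/allP => a; rewrite -rootf; exact: fp.
  by rewrite uniq_rootsE map_inj_uniq ?enum_uniq.
set S := (X in set_bij X).
pose P H := [set gh |
  monic_factorizations k n f gh /\ concomitant_space n k f gh.1 = H].
pose phi H := xget (0, 0) (P H).
have phiP H : S H -> P H (phi H).
  move=> [Hbox Hlam]; apply: xgetPex.
  have n1 : (0 < n.-1)%N by lia.
  have [||||g [h gh]]  :=
    @exists_monic_factorization _ n k f hk hnk fm sf H (t (Ordinal n1)).
  - exact: ft.
  - exact: f_sep.
  - by move=> a; rewrite rootf => /mapP[i _ ->]; exact: Hbox.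
  - exact: Hlam.
  by exists (g, h).
have phiK gh : monic_factorizations k n f gh ->
    S (concomitant_space n k f gh.1) /\ phi (concomitant_space n k f gh.1) = gh.
  case: gh => g h fgh.
  have SH : S (concomitant_space n k f g).
    split=> [i _|]; last exact: concomitant_space_Schubert_lambda fgh.
    exact: concomitant_space_Schubert_box fgh (ft i).
  split=> //=; have := phiP _ SH; case: (phi _) => g' h' [fgh' eqgg'].
  exact: concomitant_space_inj fgh' fgh eqgg'.
exists phi; split.
- by move=> H /phiP[].
- move=> H H' /set_mem/phiP[_ HE] /set_mem/phiP[_ HE'] eqphi.
  by rewrite -HE -HE' eqphi.
- move=> gh /phiK[SH <-]; exact: imageP.
Qed.
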